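(* For every $b\in[-1,1]$ the function $L_b$ is an absolutely continuous copula, with density $$c_b(u,v)=1+\sigma(u)\,g_b'(v)\qquad\text{for a.e. }(u,v)\in[0,1]^2,$$ so that $c_b$ takes only the values $0$, $1$ and $2$. Its Markov kernel is $$\partial_1L_b(u,v)=\begin{cases}F_b^+(v), & 0<u<\tfrac12,\\ F_b^-(v), & \tfrac12<u<1,\end{cases}$$ where $F_b^{\pm}(v)=v\pm g_b(v)$, $v\in[0,1]$, are distribution functions on $[0,1]$ with $\tfrac12F_b^+(v)+\tfrac12F_b^-(v)=v$ for all $v\in[0,1]$.
   Context: A bivariate copula is a function $C\colon[0,1]^2\to[0,1]$ with $C(u,0)=C(0,v)=0$, $C(u,1)=u$, $C(1,v)=v$ for all $u,v\in[0,1]$, and $C(v_1,v_2)-C(u_1,v_2)-C(v_1,u_2)+C(u_1,u_2)\ge 0$ whenever $u_1\le v_1$, $u_2\le v_2$. It is absolutely continuous with density $c\geq 0$ if $C(u,v)=\int_0^u\int_0^v c(s,t)\,\mathrm{d}t\,\mathrm{d}s$ for all $(u,v)\in[0,1]^2$. The Markov kernel of $C$ refers to $K_C(u,[0,v])$, a regular conditional distribution of the second coordinate given the first under $C$, which is represented by $\partial_1C(u,v)$ for a.e. $u$. For $b\in[-1,1]$ put $r=|b|$ and $\varepsilon=\operatorname{sgn}(b)$ (with $\operatorname{sgn}(0)=0$), $\alpha_b=(1-r)/2$, $\gamma_b=(1+r)/2$, and define, with $(x)_+=\max\{x,0\}$, $$g_b(v)=\varepsilon\Bigl(\tfrac r2-\bigl|v-\tfrac12\bigr|\Bigr)_+\quad(0\le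 v\le 1),\qquad \ell(u)=\min\{u,1-u\}\quad(0\le u\le1),$$ $$L_b(u,v)=uv+\ell(u)\,g_b(v),\qquad (u,v)\in[0,1]^2.$$ The a.e. derivative of $g_b$ is $g_b'(v)=\varepsilon\mathbf{1}_{(\alpha_b,1/2)}(v)-\varepsilon\mathbf{1}_{(1/2,\gamma_b)}(v)$. Further, $\sigma(u)=1$ for $0<u<\tfrac12$ and $\sigma(u)=-1$ for $\tfrac12<u<1$. *)

(* Defs.v *)
From HB Require Import structures.
From mathcomp Require Import all_boot all_order all_algebra.
From mathcomp Require Import all_classical all_reals all_analysis.
From mathcomp Require Import lra.

Set Implicit Arguments.
Unset Strict Implicit.
Unset Printing Implicit Defensive.

Import Order.TTheory GRing.Theory Num.Theory.
Import numFieldNormedType.Exports.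

Local Open Scope classical_set_scope.
Local Open Scope ring_scope.

Section Copulas.
Context {R : realType}.

(* Functions on [0,1] and on [0,1]^2 are total functions on R and R * R; only
   their values on the unit interval and the unit square are constrained. *)
Definition unit_itv : set R := `[0, 1].

Definition unit_square : set (R * R) := unit_itv `*` unit_itv.

Record is_copula (C : R -> R -> R) : Prop := IsCopula {
  copula_range : forall u v, unit_itv u -> unit_itv v -> unit_itv (C u v);
  copula_u0 : forall u, unit_itv u -> C u 0 = 0;
  copula_0v : forall v, unit_itv v -> C 0 v = 0;
  copula_u1 : forall u, unit_itv u -> C u 1 = u;
  copula_1v : forall v, unit_itv v -> C 1 v = v;
  copula_2increasing : forall u1 u2 v1 v2,
    unit_itv u1 -> unit_itv u2 -> unit_itv v1 -> unit_itv v2 ->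
    u1 <= v1 -> u2 <= v2 ->
    0 <= C v1 v2 - C u1 v2 - C v1 u2 + C u1 u2 }.

Record is_copula_density (C : R -> R -> R) (c : R * R -> R) : Prop :=
  IsCopulaDensity {
  density_measurable : measurable_fun unit_square c;
  density_ge0 : forall z, unit_square z -> 0 <= c z;
  density_integral : forall u v, unit_itv u -> unit_itv v ->
    (C u v)%:E = (\int[lebesgue_measure]_(s in `[0%R, u])
                    \int[lebesgue_measure]_(t in `[0%R, v]) (c (s, t))%:E)%E }.

(* P is the probability measure on the plane induced by the copula C; taking
   u = v = 1 shows that it is carried by the unit square. *)
Definition copula_law (C : R -> R -> R) (P : probability (R * R)%type R) :=
  forall u v, unit_itv u -> unit_itv v ->
    P (`[0, u]%classic `*` `[0, v]%classic) = (C u v)%:E.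

(* K is a regular conditional distribution of the second coordinate given the
   first under P: integrals over A `*` setT of functions of the first coordinate
   are integrals over A with respect to the first marginal of P. *)
Definition regular_conditional (P : probability (R * R)%type R)
    (K : R.-pker R ~> R) :=
  forall A B : set R, measurable A -> measurable B ->
    P (A `*` B) = (\int[P]_(z in A `*` setT) K z.1 B)%E.

Definition is_markov_kernel (C : R -> R -> R) (K : R.-pker R ~> R) :=
  exists2 P : probability (R * R)%type R,
    copula_law C P & regular_conditional P K.

Definition is_distribution_function (F : R -> R) :=
  exists2 P : probability R R, P unit_itv = 1%E &
    forall v, unit_itv v -> P `[0, v]%classic = (F v)%:E.

End Copulas.

Section Lb.
Context {R : realType}.
Implicit Types b u v : R.

Definition alphab b : R := (1 - `|b|) / 2.
Definition gammab b : R := (1 + `|b|) / 2.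

Definition gb b v : R := Num.sg b * Num.max (`|b| / 2 - `|v - 2^-1|) 0.

Definition ell u : R := Num.min u (1 - u).

Definition Lb b u v : R := u * v + ell u * gb b v.

Definition dgb b v : R :=
  Num.sg b * \1_(`]alphab b, 2^-1[%classic : set R) v
  - Num.sg b * \1_(`]2^-1, gammab b[%classic : set R) v.

(* The value of sigma off ]0, 1/2[ and ]1/2, 1[, where it is immaterial, is set
   to 0. *)
Definition sigma u : R :=
  \1_(`]0, 2^-1[%classic : set R) u - \1_(`]2^-1, 1[%classic : set R) u.

Definition cb b (z : R * R) : R := 1 + sigma z.1 * dgb b z.2.

Definition Fplus b v : R := v + gb b v.
Definition Fminus b v : R := v - gb b v.

Lemma is_derive_gb b v :
  v != alphab b -> v != 2^-1 -> v != gammab b -> is_derive v 1 (gb b) (dgb b v).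
Proof.
have near_is (I : interval R) (h : R -> R) (df : R) :
    open [set` I] -> v \in I -> (forall x, x \in I -> gb b x = h x) ->
    is_derive v 1 h df -> is_derive v 1 (gb b) df.
  move=> oI vI ghI hdf; apply: near_eq_is_derive hdf.
  by near=> x; apply/esym/ghI; near: x; exact: (open_nbhs_nbhs (conj oI vI)).
have r0 : 0 <= `|b| by [].
move=> va vh vg; rewrite /dgb !indicE !mem_setE !in_itv/=.
have aE : alphab b = (1 - `|b|) / 2 by [].
have gE : gammab b = (1 + `|b|) / 2 by [].
case: (ltgtP v (alphab b)) va => // va _.
  rewrite (_ : (2^-1 < v) = false) /= ?mulr0 ?subr0; last by lra.
  apply: (near_is `]-oo, alphab b[ (cst 0)) => //.
  move=> x; rewrite in_itv/= => xa; rewrite /gb max_r ?mulr0//.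
  by rewrite (@ltr0_norm _ (x - 2^-1)); lra.
case: (ltgtP v 2^-1) vh => // vh _ /=.
  rewrite mulr1 mulr0 subr0.
  apply: (near_is `]alphab b, 2^-1[
    (fun x => Num.sg b * (`|b| / 2 - 2^-1 + x))) => //.
    by rewrite in_itv/= va.
    move=> x; rewrite in_itv/= => /andP[xa xh]; rewrite /gb max_l.
      by congr (_ * _); rewrite (@ltr0_norm _ (x - 2^-1)); lra.
    by rewrite (@ltr0_norm _ (x - 2^-1)); lra.
  by apply: is_derive_eq; rewrite ?add0r /GRing.scale /= ?mulr1 ?mulr0 ?addr0.
case: (ltgtP v (gammab b)) vg => // vg _ /=.
  rewrite mulr1 mulr0 sub0r.
  apply: (near_is `]2^-1, gammab b[
    (fun x => Num.sg b * (`|b| / 2 + 2^-1 - x))) => //.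
    by rewrite in_itv/= vh.
    move=> x; rewrite in_itv/= => /andP[xh xg]; rewrite /gb max_l.
      by congr (_ * _); rewrite (@gtr0_norm _ (x - 2^-1)); lra.
    by rewrite (@gtr0_norm _ (x - 2^-1)); lra.
  apply: is_derive_eq; rewrite /GRing.scale /= ?add0r ?sub0r ?mulr0 ?addr0.
  by rewrite ?mulrN1 ?mulrN ?mulr1.
rewrite mulr0 subr0.
apply: (near_is `]gammab b, +oo[ (cst 0)) => //.
  by rewrite in_itv/= vg.
move=> x; rewrite in_itv/= andbT => xg; rewrite /gb max_r ?mulr0//.
by rewrite (@gtr0_norm _ (x - 2^-1)); lra.
Unshelve. all: by end_near.
Qed.

End Lb.

(* Main.v *)
From HB Require Import structures.
Require Import Defs.
From mathcomp Require Import all_boot all_order all_algebra.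
From mathcomp Require Import all_classical all_reals all_analysis.
From mathcomp Require Import measurable_realfun ring lra.

Set Implicit Arguments.
Unset Strict Implicit.
Unset Printing Implicit Defensive.

Import Order.TTheory GRing.Theory Num.Theory.
Import numFieldNormedType.Exports.

Local Open Scope classical_set_scope.
Local Open Scope ring_scope.

(** The functions [ell] and [g_b] are both tents: with
    [tent a v = (1/2 - a - |v - 1/2|)_+], one has [ell = tent 0] on [0, 1] and
    [g_b = sgn(b) tent alpha_b].  A tent is 1-Lipschitz and is the primitive of
    the step function equal to 1 on ]a, 1/2[, to -1 on ]1/2, 1 - a[ and to 0
    elsewhere ([integral_dtent]).  Two consequences:

    - the [L_b]-volume of a rectangle with sides x and y is x y + p q, where p
      and q are increments of [ell] and [g_b], so that |p| <= x and |q| <= y;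
      hence it is nonnegative and [L_b] is a copula;

    - integrating [c_b(s, .)] over [0, v] gives v + sigma(s) g_b(v), which is
      F_b^+ or F_b^- according to the half in which s lies, and integrating this
      over [0, u] gives [L_b(u, v)].  Since [c_b] takes the values 0, 1 and 2
      only, it is a density of [L_b] with probability densities as sections.

    The kernel s |-> [c_b(s, t) dt] on [0, 1] is then a Markov kernel of [L_b]
    ([copula_density_kernel]): any density of a copula disintegrates its law,
    whose first marginal is uniform.

    The uniqueness statements hold for every copula.  A copula determines its
    law on the quadrants, and these form a generating pi-system
    ([copula_law_unique]).  Densities of the same law have the same integral
    over every measurable set, so they agree almost everywhere; for a fixed B
    the same reasoning on the sets A x B gives, for two Markov kernels,
    K(s, B) = K'(s, B) for almost every s.  With B = [0, q], q rational, one
    exceptional null set serves all q at once, and as the distribution functions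
    F_b^+ and F_b^- are Lipschitz, monotonicity extends the equality from
    rational q to every v in [0, 1] ([eq_cdf_rat]). *)

(** * Measures with equal distribution functions *)

Section distribution_functions.
Context {R : realType}.

Lemma measurable_gen_halfline :
  @measurable _ R = <<s [set `]-oo, x]%classic | x in [set: R]] >>.
Proof.
rewrite -[LHS]/((@ocitv R).-sigma.-measurable) RGenOInfty.measurableE.
rewrite eqEsubset; split; apply: smallest_sub;
  try exact: smallest_sigma_algebra.
  move=> _ [x ->]; rewrite -setCitvl; apply: sigma_algebraC.
  by apply: sub_gen_smallest; exists x.
move=> _ [x _ <-]; rewrite -setCitvr; apply: sigma_algebraC.
by apply: sub_gen_smallest; exists x.
Qed.

Lemma eq_measure_halfline (m1 m2 : {measure set R -> \bar R}) :
  (m1 setT < +oo)%E ->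
  (forall x, m1 `]-oo, x]%classic = m2 `]-oo, x]%classic) ->
  forall A, measurable A -> m1 A = m2 A.
Proof.
move=> m1oo m12.
apply: (measure_unique [set `]-oo, x]%classic | x in [set: R]]
  (fun n => `]-oo, n%:R]%classic)).
- exact: measurable_gen_halfline.
- move=> _ _ [x _ <-] [y _ <-]; exists (Num.min x y) => //.
  by apply/seteqP; split => z /=; rewrite !in_itv/= le_min => /andP.
- by move=> n; exists n%:R.
- apply/seteqP; split => // x _; exists (Num.truncn `|x|).+1 => //=.
  by rewrite in_itv/= (le_trans (ler_norm x))// ltW// truncnS_gt.
- by move=> _ [x _ <-].
- move=> n; apply: le_lt_trans m1oo; apply: le_measure; rewrite ?inE//.
Qed.

(** The one-dimensional result applies twice: to the first projection of the
    measures restricted to the strip of ordinates at most y, and then to the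
    second projection of the measures restricted to A x R.  This gives equality
    on rectangles. *)
Lemma eq_measure_quadrant (m1 m2 : {measure set (R * R) -> \bar R}) :
  (m1 setT < +oo)%E ->
  (forall x y, m1 (`]-oo, x]%classic `*` `]-oo, y]%classic) =
               m2 (`]-oo, x]%classic `*` `]-oo, y]%classic)) ->
  forall A, measurable A -> m1 A = m2 A.
Proof.
move=> m1oo m12.
have bounded A : measurable A -> (m1 A < +oo)%E.
  by move=> mA; apply: le_lt_trans m1oo; apply: le_measure; rewrite ?inE.
have mT (B : set R) : measurable B -> measurable ([set: R] `*` B).
  by move=> mB; exact: measurableX.
have mT' (B : set R) : measurable B -> measurable (B `*` [set: R]).
  by move=> mB; exact: measurableX.
have strip y A : measurable A ->
    m1 (A `*` `]-oo, y]%classic) = m2 (A `*` `]-oo, y]%classic).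
  move=> mA; have mS := mT `]-oo, y]%classic (measurable_itv _).
  have E m B : pushforward (mrestr m mS) fst B =
      m (B `*` `]-oo, y]%classic) :> \bar R.
    rewrite /pushforward /mrestr; congr m.
    by apply/seteqP; split => -[s t] /=; tauto.
  rewrite -!E; apply: eq_measure_halfline => //.
    by rewrite [ltLHS]E bounded//; exact: measurableX.
  by move=> x; rewrite [LHS]E [RHS]E m12.
have rectangle A B : measurable A -> measurable B ->
    m1 (A `*` B) = m2 (A `*` B).
  move=> mA mB; have mS := mT' A mA.
  have E m C : pushforward (mrestr m mS) snd C = m (A `*` C) :> \bar R.
    rewrite /pushforward /mrestr; congr m.
    by apply/seteqP; split => -[s t] /=; tauto.
  rewrite -!E; apply: eq_measure_halfline => //.
    by rewrite [ltLHS]E bounded//; exact: measurableX.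
  by move=> x; rewrite [LHS]E [RHS]E strip.
apply: (measure_unique
  [set A `*` B | A in @measurable _ R & B in @measurable _ R]
  (fun=> setT)).
- exact: measurable_prod_measurableType.
- move=> _ _ [A mA [B mB <-]] [A' mA' [B' mB' <-]].
  exists (A `&` A'); first exact: measurableI.
  by exists (B `&` B'); [exact: measurableI|rewrite setXI].
- by move=> _; exists setT => //; exists setT => //; rewrite setXTT.
- by rewrite bigcup_const.
- by move=> _ [A mA [B mB <-]]; exact: rectangle.
- by [].
Qed.

End distribution_functions.

(** * Laws and kernels given by densities *)

(** The part of A outside D is null for the restricted measure, and on subsets
    of D both measures coincide. *)
Lemma ge0_integral_mrestr d (T : measurableType d) (R : realType)
    (mu : {measure set T -> \bar R})
    (D A : set T) (mD : measurable D) (g : T -> \bar R) :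
  measurable A -> measurable_fun setT g -> (forall x, 0 <= g x)%E ->
  (\int[mrestr mu mD]_(x in A) g x = \int[mu]_(x in A `&` D) g x)%E.
Proof.
move=> mA mg g0.
have mAD : measurable (A `&` D) by exact: measurableI.
have mACD : measurable (A `\` D) by exact: measurableD.
rewrite -{1}(setUIDK A D) ge0_integral_setU//; last 2 first.
- by apply: measurable_funTS.
- by apply/disj_setPS => x [[_ ?] []].
rewrite [X in (_ + X)%E](eq_measure_integral mzero)
  ?integral_measure_zero ?adde0.
  apply: eq_measure_integral => B mB BAD.
  by rewrite /= /mrestr setIidl// => x /BAD[].
move=> B mB BAD.
by rewrite /= /mrestr (_ : B `&` D = set0) ?measure0// -subset0 => x [/BAD[]].
Qed.

Lemma ge0_integral_setX d1 d2 (T1 : measurableType d1) (T2 : measurableType d2)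
    (R : realType) (m1 : {sigma_finite_measure set T1 -> \bar R})
    (m2 : {sigma_finite_measure set T2 -> \bar R}) (f : T1 * T2 -> \bar R) A B :
  measurable_fun (A `*` B) f -> (forall z, (A `*` B) z -> 0 <= f z)%E ->
  measurable A -> measurable B ->
  (\int[m1 \x m2]_(z in A `*` B) f z =
   \int[m1]_(x in A) \int[m2]_(y in B) f (x, y))%E.
Proof.
move=> mf f0 mA mB.
rewrite integral_mkcond fubini_tonelli1; first last.
- by apply: erestrict_ge0.
- by apply/(measurable_restrictT _ _).1 => //; exact: measurableX.
rewrite [RHS]integral_mkcond; apply: eq_integral => x _.
rewrite /fubini_F patchE; case: ifPn => [/set_mem xA|/negP xA].
  rewrite [RHS]integral_mkcond; apply: eq_integral => y _; rewrite !patchE.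
  by congr (if _ then _ else _); apply/idP/idP; rewrite !inE => //= -[].
rewrite integral0_eq// => y _; rewrite patchE ifF//.
by apply/negP => /set_mem[/= /mem_set].
Qed.

Section density_law.
Context d1 d2 (T1 : measurableType d1) (T2 : measurableType d2) (R : realType).
Variables (mu : {measure set T1 -> \bar R}) (phi : T1 -> T2) (f : T1 -> \bar R).

(** The image by [phi] of the measure with density [f] with respect to [mu].
    Taking [phi] to be the identity transports the law between two Borel
    structures on R: the one that carries the Lebesgue measure and the canonical
    one.  The hypotheses are arguments so that the instances below apply. *)
Definition density_law (mphi : measurable_fun setT phi)
    (mf : measurable_fun setT f) (f0 : forall x, (0 <= f x)%E)
    (f1 : (\int[mu]_x f x = 1)%E) (A : set T2) : \bar R :=
  (\int[mu]_(x in phi @^-1` A) f x)%E.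

Hypotheses (mphi : measurable_fun setT phi) (mf : measurable_fun setT f)
  (f0 : forall x, (0 <= f x)%E) (f1 : (\int[mu]_x f x = 1)%E).
Local Notation P := (density_law mphi mf f0 f1).

Let P0 : P set0 = 0%E.
Proof. by rewrite /P preimage_set0 integral_set0. Qed.

Let P_ge0 A : (0 <= P A)%E.
Proof. by apply: integral_ge0 => x _; exact: f0. Qed.

Let P_sigma_additive : semi_sigma_additive P.
Proof.
move=> F mF tF mUF.
have mpre (B : set T2) : measurable B -> measurable (phi @^-1` B).
  by move=> mB; rewrite -[_ @^-1` _]setTI; exact: mphi.
rewrite /P preimage_bigcup.
apply: (semi_sigma_additive_nng_induced (mu := mu) mf f0).
- by move=> n; exact: mpre.
- apply/trivIsetP => /= i j _ _ ij; rewrite -preimage_setI.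
  by move/trivIsetP : tF => /(_ _ _ _ _ ij) ->//; rewrite preimage_set0.
- by rewrite -preimage_bigcup; exact: mpre.
Qed.

HB.instance Definition _ := isMeasure.Build _ _ _ P P0 P_ge0 P_sigma_additive.

Let P_setT : P setT = 1%E.
Proof. by rewrite /P preimage_setT f1. Qed.

HB.instance Definition _ := Measure_isProbability.Build _ _ _ P P_setT.

End density_law.

Section density_kernel.
Context d1 d2 d3 (T1 : measurableType d1) (T2 : measurableType d2)
  (T3 : measurableType d3) (R : realType).
Variables (mu : {sigma_finite_measure set T2 -> \bar R}) (phi : T2 -> T3)
  (f : T1 * T2 -> \bar R).

Lemma measurable_section (mf : measurable_fun setT f) s :
  measurable_fun setT (fun t => f (s, t)).
Proof. exact: measurableT_comp. Qed.

(** The kernel whose value at [s] has density [f(s, .)]; it is measurable in [s]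
    by Tonelli's theorem. *)
Definition density_kernel (mphi : measurable_fun setT phi)
    (mf : measurable_fun setT f) (f0 : forall z, (0 <= f z)%E)
    (f1 : forall s, (\int[mu]_t f (s, t) = 1)%E) (s : T1) :
    {measure set T3 -> \bar R} :=
  density_law mphi (measurable_section mf s) (fun t => f0 (s, t)) (f1 s).

Hypotheses (mphi : measurable_fun setT phi) (mf : measurable_fun setT f)
  (f0 : forall z, (0 <= f z)%E) (f1 : forall s, (\int[mu]_t f (s, t) = 1)%E).
Local Notation K := (density_kernel mphi mf f0 f1).

Let measurable_K (B : set T3) : measurable B -> measurable_fun setT (K ^~ B).
Proof.
move=> mB; have mB' : measurable (phi @^-1` B).
  by rewrite -[_ @^-1` _]setTI; exact: mphi.
apply: (eq_measurable_fun (fubini_F mu (f \_ (setT `*` (phi @^-1` B))))).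
  move=> s _; rewrite /= /density_law [RHS]integral_mkcond.
  apply: eq_integral => t _; rewrite !patchE.
  by congr (if _ then _ else _); apply/idP/idP; rewrite !inE => //= -[].
apply: measurable_fun_fubini_tonelli_F.
- apply/(measurable_restrictT _ _).1; first exact: measurableX.
  exact: measurable_funTS.
- exact: erestrict_ge0.
Qed.

HB.instance Definition _ := isKernel.Build _ _ _ _ _ K measurable_K.

Let K_prob s : K s setT = 1%E.
Proof. exact: probability_setT. Qed.

HB.instance Definition _ := Kernel_isProbability.Build _ _ _ _ _ K K_prob.

End density_kernel.

#[local] Instance ae_filter_lebesgue (R : realType) :
  Filter (almost_everywhere (@lebesgue_measure R)).
Proof. exact: ae_filter_ringOfSetsType. Qed.

(** * Uniqueness of laws, densities and Markov kernels of a copula *)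

Section copula_laws.
Context {R : realType}.
Local Notation leb := (@lebesgue_measure R).
Local Notation I := (@unit_itv R).

Lemma measurable_unit_itv : measurable I.
Proof. exact: measurable_itv. Qed.

Lemma measurable_unit_square : measurable (@unit_square R).
Proof. by apply: measurableX; exact: measurable_unit_itv. Qed.

Lemma unit_itv0 : I 0.
Proof. by rewrite /unit_itv/= in_itv/= lexx ler01. Qed.

Lemma unit_itv1 : I 1.
Proof. by rewrite /unit_itv/= in_itv/= lexx ler01. Qed.

Lemma unit_itvE (x : R) : I x = (0 <= x <= 1) :> Prop.
Proof. by rewrite /unit_itv/= in_itv/=. Qed.

Lemma lebesgue_unit_itv : leb I = 1%E.
Proof. by rewrite lebesgue_measure_itv/= lte_fin ltr01 oppr0 adde0. Qed.

Lemma sub_unit_itv (u : R) : I u -> `[0, u]%classic `<=` I.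
Proof.
rewrite unit_itvE => /andP[_ u1] x; rewrite unit_itvE/= in_itv/=.
by move=> /andP[-> /le_trans ->].
Qed.

Lemma halflineI (x : R) :
  [set` `]-oo, x]] `&` I = if 0 <= x then [set` `[0, Num.min x 1]] else set0.
Proof.
case: ifPn => x0; apply/seteqP; split => t //=;
  rewrite /unit_itv/= !in_itv/= ?le_min.
- by move=> [-> /andP[-> ->]].
- by move=> /and3P[-> -> ->].
- by move=> [tx /andP[t0 _]]; move: x0; rewrite (le_trans t0 tx).
Qed.

Variables (C : R -> R -> R) (hC : is_copula C).

(** A copula law gives mass C(1, 1) = 1 to the unit square, so its complement is
    negligible. *)
Lemma copula_law_unit_square (P : probability (R * R)%type R) :
  copula_law C P -> forall A, measurable A -> P (A `&` unit_square) = P A.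
Proof.
move=> CP A mA; have mS := measurable_unit_square.
have PS : P unit_square = 1%E.
  by rewrite [LHS](CP 1 1 unit_itv1 unit_itv1) (copula_u1 hC unit_itv1).
have PSC : P (~` unit_square) = 0%E by rewrite probability_setC// PS subee.
rewrite [RHS](_ : _ =
    P (A `&` unit_square `|` A `&` ~` unit_square)); last first.
  by rewrite -setIUr setUv setIT.
rewrite measureU//; first last.
- by rewrite setIACA setICr setI0.
- by apply: measurableI => //; exact: measurableC.
- exact: measurableI.
rewrite [X in (_ + X)%E](_ : _ = 0%E) ?adde0//.
apply: (@subset_measure0 _ _ _ _ _ (~` unit_square)) => //.
- by apply: measurableI => //; exact: measurableC.
- exact: measurableC.
Qed.

(** After intersection with the unit square, a quadrant is empty or a rectangle
    [0, u] x [0, v], whose mass is C(u, v). *)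
Lemma copula_law_unique (P1 P2 : probability (R * R)%type R) :
  copula_law C P1 -> copula_law C P2 -> forall A, measurable A -> P1 A = P2 A.
Proof.
move=> CP1 CP2; apply: eq_measure_quadrant => [|x y].
  by rewrite [ltLHS](@probability_setT _ _ _ P1) ltry.
have mQ : measurable (`]-oo, x]%classic `*` `]-oo, y]%classic : set (R * R)).
  by apply: measurableX; exact: measurable_itv.
rewrite -[LHS](copula_law_unit_square CP1 mQ).
rewrite -[RHS](copula_law_unit_square CP2 mQ).
rewrite /unit_square -setXI !halflineI.
case: ifPn => x0; last by rewrite !set0X !measure0.
case: ifPn => y0; last by rewrite !setX0 !measure0.
have minI (z : R) : 0 <= z -> I (Num.min z 1).
  by move=> z0; rewrite unit_itvE le_min z0 ler01 ge_min lexx orbT.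
by rewrite (CP1 _ _ (minI _ x0) (minI _ y0)) (CP2 _ _ (minI _ x0) (minI _ y0)).
Qed.

(** The first marginal of a copula law is uniform on [0, 1]: its distribution
    function is u |-> C(u, 1) = u. *)
Lemma copula_law_marginal (P : probability (R * R)%type R) (g : R -> \bar R) A :
  copula_law C P -> measurable_fun setT g -> (forall x, 0 <= g x)%E ->
  measurable A ->
  (\int[P]_(z in A `*` setT) g z.1 = \int[leb]_(s in A `&` I) g s)%E.
Proof.
move=> CP mg g0 mA.
have mI := measurable_unit_itv.
have -> : A `*` setT = fst @^-1` A :> set (R * R).
  by apply/seteqP; split => -[s t] /=; tauto.
have -> : (\int[P]_(z in fst @^-1` A) g z.1 =
           \int[pushforward P fst]_(s in A) g s)%E.
  rewrite ge0_integral_pushforward//; exact: measurable_funS mg.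
pose m2 := pushforward (mrestr leb mI) (id : measurableTypeR R -> R).
have mid : measurable_fun setT (id : measurableTypeR R -> R) by [].
have fin : (pushforward P fst setT < +oo)%E.
  by rewrite /pushforward preimage_setT probability_setT ltry.
have E B : measurable B -> pushforward P fst B = m2 B.
  apply: eq_measure_halfline => // x.
  transitivity (P ((`]-oo, x]%classic `&` I) `*` I)).
    rewrite -{2}(setTI I) setXI (copula_law_unit_square CP); last first.
      by apply: measurableX => //; exact: measurable_itv.
    by congr (P _); apply/seteqP; split => -[s t] /=; tauto.
  transitivity (leb (`]-oo, x]%classic `&` I)); last by [].
  rewrite halflineI; case: ifPn => x0; last by rewrite set0X !measure0.
  have Im : I (Num.min x 1).
    by rewrite unit_itvE le_min x0 ler01 ge_min lexx orbT.
  rewrite (CP _ _ Im unit_itv1) (copula_u1 hC Im).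
  rewrite lebesgue_measure_itv/= lte_fin.
  move: Im; rewrite unit_itvE => /andP[m0 _].
  by case: ltP => [_|h]; rewrite ?oppr0 ?adde0 ?sube0//; congr EFin; lra.
rewrite (eq_measure_integral m2); last by move=> B mB _; exact: E.
rewrite ge0_integral_pushforward//; last exact: measurable_funS mg.
by rewrite ge0_integral_mrestr.
Qed.

(** Both kernels have integral P(A x B) over A in [0, 1] with respect to the
    uniform marginal, for the unique law P of the copula.  The exceptional null
    set depends on B. *)
Lemma markov_kernel_ae_unique (K1 K2 : R.-pker R ~> R) (B : set R) :
  is_markov_kernel C K1 -> is_markov_kernel C K2 -> measurable B ->
  {ae leb, forall u, I u -> K1 u B = K2 u B}.
Proof.
move=> [P1 CP1 rP1] [P2 CP2 rP2] mB.
have mI := measurable_unit_itv.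
have mK (K : R.-pker R ~> R) : measurable_fun setT (K ^~ B).
  by exact: measurable_kernel.
have intK (K : R.-pker R ~> R) : leb.-integrable I (K ^~ B).
  apply: (@le_integrable _ _ _ _ _ _ _ (cst 1%E)) => //.
  - by apply: measurable_funTS; exact: mK.
  - move=> x _; rewrite /= gee0_abs// normr1.
    by rewrite -(prob_kernel (s := K) x) le_measure// inE.
  - apply/integrableP; split=> //.
    under eq_integral do rewrite /= normr1.
    by rewrite integral_cst// mul1e [ltLHS]lebesgue_unit_itv ltry.
apply: integral_ae_eq => //.
- by apply: measurable_funTS; exact: mK.
move=> E EI mE; rewrite -(setIidl EI).
rewrite -(copula_law_marginal CP1 (mK K1))// -rP1//.
rewrite -(copula_law_marginal CP2 (mK K2))// -rP2//.
by apply: (copula_law_unique CP1 CP2); exact: measurableX.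
Qed.

Section density.
Variable c : R * R -> R.
Hypothesis dc : is_copula_density C c.

(** Tonelli's theorem turns the iterated integrals that define a density into
    integrals over rectangles of the plane; extending [c] by 0 off the unit
    square gives a measure of total mass C(1, 1) = 1. *)
Lemma copula_density_law : exists P : probability (R * R)%type R,
  copula_law C P /\
  forall A, measurable A ->
    P A = (\int[leb \x leb]_(z in A `&` unit_square) (c z)%:E)%E.
Proof.
have mS := measurable_unit_square.
pose f := (EFin \o c) \_ unit_square.
have mf : measurable_fun setT f.
  apply/(measurable_restrictT _ _).1 => //.
  by apply/measurable_EFinP; exact: (density_measurable dc).
have f0 z : (0 <= f z)%E.
  by apply: erestrict_ge0 => {}z zS; rewrite lee_fin (density_ge0 dc).
have rect u v : I u -> I v ->
    (\int[leb \x leb]_(z in `[0%R, u] `*` `[0%R, v]) f z = (C u v)%:E)%E.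
  move=> Iu Iv.
  rewrite ge0_integral_setX//; last exact: measurable_funTS.
  rewrite (density_integral dc)//; apply: eq_integral => s /set_mem su.
  apply: eq_integral => t /set_mem tv; rewrite /f patchE ifT// inE.
  by split; [exact: sub_unit_itv su|exact: sub_unit_itv tv].
have f1 : (\int[leb \x leb]_z f z = 1)%E.
  rewrite -integral_mkcond.
  rewrite [RHS](_ : _ = (C 1 1)%:E); last first.
    by rewrite (copula_u1 hC)//; exact: unit_itv1.
  rewrite -rect; try exact: unit_itv1.
  by apply: eq_integral => z zS; rewrite /f patchE ifT.
have mid : measurable_fun setT
    (id : measurableTypeR R * measurableTypeR R -> R * R) by [].
exists (density_law mid mf f0 f1); split.
  by move=> u v Iu Iv; rewrite -rect.
by move=> A mA; rewrite integral_mkcondr.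
Qed.

(** Sections of the density disintegrate the law: P(A x B) is the integral over
    A of K(s, B) by Tonelli's theorem, and the first marginal is uniform. *)
Lemma copula_density_kernel (K : R.-pker R ~> R) :
  (forall s, I s -> forall B, measurable B ->
     K s B = \int[leb]_(t in B `&` I) (c (s, t))%:E)%E ->
  is_markov_kernel C K.
Proof.
move=> KE; have [P [CP PE]] := copula_density_law.
exists P => // A B mA mB.
rewrite PE; last exact: measurableX.
rewrite -setXI (copula_law_marginal CP (measurable_kernel K B mB))//.
have mI := measurable_unit_itv.
have sub : (A `&` I) `*` (B `&` I) `<=` unit_square by move=> z [[_ ?] [_ ?]].
rewrite ge0_integral_setX//.
- by apply: eq_integral => s /set_mem[_ sI]; rewrite KE.
- apply: (measurable_funS _ sub); first exact: measurable_unit_square.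
  by apply/measurable_EFinP; exact: (density_measurable dc).
- by move=> z /sub zS; rewrite lee_fin (density_ge0 dc).
- exact: measurableI.
- exact: measurableI.
Qed.

End density.

(** The integrals of [c1] and [c2] over a measurable part of the unit square are
    both its mass under the unique law of the copula. *)
Lemma copula_density_ae_unique (c1 c2 : R * R -> R) :
  is_copula_density C c1 -> is_copula_density C c2 ->
  {ae (leb \x leb)%E, forall z, unit_square z -> c1 z = c2 z}.
Proof.
move=> dc1 dc2; have [P1 [CP1 P1E]] := copula_density_law dc1.
have [P2 [CP2 P2E]] := copula_density_law dc2.
have mS := measurable_unit_square.
have mc c : is_copula_density C c ->
    measurable_fun (@unit_square R) (EFin \o c).
  by move=> dc; apply/measurable_EFinP; exact: (density_measurable dc).
have : ae_eq (leb \x leb)%E unit_square (EFin \o c1) (EFin \o c2).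
  apply: integral_ae_eq => //.
  - apply/integrableP; split; first exact: mc.
    apply: (@le_lt_trans _ _ (P1 setT)).
      rewrite P1E// setTI le_eqVlt; apply/orP; left; apply/eqP/eq_integral.
      by move=> z /set_mem zS; rewrite /= ger0_norm// (density_ge0 dc1).
    by rewrite probability_setT ltry.
  - exact: mc.
  - move=> E ES mE; rewrite -(setIidl ES) -P1E// -P2E//.
    exact: (copula_law_unique CP1 CP2).
by apply: filterS => z h zS; move: (h zS) => -[].
Qed.

End copula_laws.

(** The mass of [0, v] lies between those of [0, q] and [0, q'] for rationals
    q < v < q' as close to v as desired.  At the end points 0 and 1, which have
    no such neighbours inside [0, 1], the hypothesis applies directly. *)
Lemma eq_cdf_rat (R : realType) (m : {measure set R -> \bar R}) (F : R -> R)
    (k : R) :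
  0 < k ->
  (forall x y, x <= y -> `|F x - F y| <= k * (y - x)) ->
  (forall q : rat, unit_itv (ratr q : R) ->
     m `[0, ratr q]%classic = (F (ratr q))%:E) ->
  forall v, unit_itv v -> m `[0, v]%classic = (F v)%:E.
Proof.
move=> k0 lipF mF v Iv; have := Iv; rewrite unit_itvE => /andP[v0 v1].
have mono (x y : R) : x <= y -> (m `[0%R, x]%classic <= m `[0%R, y]%classic)%E.
  move=> xy; apply: le_measure; rewrite ?inE; try exact: measurable_itv.
  by move=> t /=; rewrite !in_itv/= => /andP[-> /le_trans ->].
apply/eqP; rewrite eq_le; apply/andP; split.
- have [->|vn1] := eqVneq v 1.
    have := mF 1%Q; rewrite rmorph1 => ->//; exact: unit_itv1.
  have {}v1 : v < 1 by rewrite lt_neqAle vn1.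
  apply/lee_addgt0Pr => e e0.
  have ek : 0 < e / k by rewrite divr_gt0.
  have [|q] := @rat_in_itvoo R v (Num.min 1 (v + e / k)).
    by rewrite lt_min v1 ltrDl.
  rewrite in_itv/= lt_min => /and3P[vq q1 qe].
  apply: le_trans (mono _ _ (ltW vq)) _.
  rewrite mF; last by rewrite unit_itvE (le_trans v0 (ltW vq)) ltW.
  rewrite -EFinD lee_fin.
  have := lipF _ _ (ltW vq); rewrite ler_norml => /andP[+ _].
  have : k * (ratr q - v) <= e by rewrite mulrC -ler_pdivlMr// lerBlDl ltW.
  lra.
- have [->|vn0] := eqVneq v 0.
    have := mF 0%Q; rewrite rmorph0 => ->//; exact: unit_itv0.
  have {}v0 : 0 < v by rewrite lt_neqAle eq_sym vn0.
  apply/lee_addgt0Pr => e e0.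
  have ek : 0 < e / k by rewrite divr_gt0.
  have [|q] := @rat_in_itvoo R (Num.max 0 (v - e / k)) v.
    by rewrite gt_max v0 ltrBlDr ltrDl.
  rewrite in_itv/= gt_max => /andP[/andP[q0 qe] qv].
  apply: le_trans (leeD2r _ (mono _ _ (ltW qv))).
  rewrite mF; last by rewrite unit_itvE (ltW q0) (le_trans (ltW qv) v1).
  rewrite -EFinD lee_fin.
  have := lipF _ _ (ltW qv); rewrite ler_norml => /andP[+ _].
  have : k * (v - ratr q) <= e by rewrite mulrC -ler_pdivlMr//; lra.
  lra.
Qed.

(** * Tent functions *)

(* Successive splitting of all maxima and minima; the innermost ones must have
   been resolved beforehand. *)
Ltac max_lra := rewrite /Order.max /Order.min;
  repeat (case: ifPn; rewrite -?leNgt => ?); lra.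

Section tent.
Context {R : realType}.
Local Notation leb := (@lebesgue_measure R).
Local Notation I := (@unit_itv R).
Implicit Types a p q u v : R.

Definition tent a v : R := Num.max (2^-1 - a - `|v - 2^-1|) 0.

(** The almost everywhere derivative of [tent a]. *)
Definition dtent a v : R :=
  \1_(`]a, 2^-1[%classic : set R) v - \1_(`]2^-1, 1 - a[%classic : set R) v.

Lemma lebesgue_itvooI p q v : 0 <= p -> 0 <= v ->
  leb (`]p, q[ `&` `[0, v]) = (Num.max (Num.min q v - p) 0)%:E.
Proof.
move=> p0 v0; have [vq|qv] := ltP v q.
  have -> : `]p, q[ `&` `[0, v] = [set` `]p, v]].
    apply/seteqP; split => t /=; rewrite !in_itv/=.
      by move=> [/andP[-> _] /andP[_ ->]].
    by move=> /andP[pt tv]; rewrite pt tv (le_lt_trans tv vq)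
      (le_trans p0 (ltW pt)).
  rewrite lebesgue_measure_itv/= lte_fin; case: ltP => pv; congr EFin;
    by case: ltP; lra.
have -> : `]p, q[ `&` `[0, v] = [set` `]p, q[].
  apply/seteqP; split => t /=; rewrite !in_itv/=; first by move=> [].
  move=> /andP[pt tq].
  by rewrite pt tq (le_trans p0 (ltW pt))
    (le_trans (ltW tq) qv).
rewrite lebesgue_measure_itv/= lte_fin; case: ltP => pv; congr EFin;
  by case: ltP; lra.
Qed.

Lemma measurable_dtent a : measurable_fun setT (dtent a).
Proof. by apply: measurable_funB; exact: measurable_indic. Qed.

(** The tent is the primitive of [dtent].  The constants serve both coordinates:
    c0 = 1 and c1 = sigma(s) sgn(b) in the inner integral of the density, then
    c0 = v and c1 = g_b(v) in the outer one. *)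
Lemma integral_dtent a c0 c1 v : 0 <= a <= 2^-1 -> I v ->
  (\int[leb]_(t in `[0%R, v]) (c0 + c1 * dtent a t)%:E)%E =
  (c0 * v + c1 * tent a v)%:E.
Proof.
move=> /andP[a0 a2]; rewrite unit_itvE => /andP[v0 v1].
have ic (c p q : R) : leb.-integrable `[0, v]
    (EFin \o (fun t => c * \1_(`]p, q[%classic : set R) t)).
  have h : leb.-integrable `[0, v]
      (fun t => (\1_(`]p, q[%classic : set R) t)%:E).
    by apply: integrableS (integrable_indic_itv p q false true).
  have mD : measurable (`[0, v]%classic : set (measurableTypeR R)).
    exact: measurable_itv.
  by have hc := integrableZl mD c h; exact: hc.
have i0 : leb.-integrable `[0, v] (EFin \o cst c0).
  apply/integrableP; split; first exact/measurable_EFinP.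
  by rewrite /= integral_cst//= lebesgue_measure_itv/=; case: ifP => _;
    rewrite -?EFinD -EFinM ltry.
have iE (c p q : R) : 0 <= p ->
    (\int[leb]_(t in `[0%R, v]) (c * \1_(`]p, q[%classic : set R) t)%:E)%E =
    (c * Num.max (Num.min q v - p) 0)%:E.
  move=> p0; under eq_integral do rewrite EFinM.
  rewrite integralZl//; last first.
    by apply: integrableS (integrable_indic_itv p q false true).
  by rewrite integral_indic// EFinM; congr (_ * _)%E; exact: lebesgue_itvooI.
transitivity (\int[leb]_(t in `[0%R, v]) ((EFin \o cst c0) t +
    ((EFin \o (fun t => (c1 * \1_(`]a, 2^-1[%classic : set R) t)%R)) t +
     (EFin \o (fun t =>
       (- c1 * \1_(`]2^-1, (1 - a)%R[%classic : set R) t)%R)) t)))%E.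
  by apply: eq_integral => t _; rewrite /= -!EFinD mulNr -mulrBr.
rewrite integralD//; last by apply: integrableD.
rewrite integralD// !iE//.
rewrite (_ : (\int[leb]_(t in _) _ = (c0 * v)%:E)%E); last first.
  transitivity (c0%:E * leb `[0%R, v])%E; first by rewrite -integral_cst.
  rewrite lebesgue_measure_itv/= lte_fin.
  case: ltP => h; first by rewrite oppr0 adde0.
  by rewrite mule0 (_ : v = 0) ?mulr0//; lra.
rewrite -!EFinD; congr EFin; rewrite mulNr -mulrBr; congr (_ + _ * _).
rewrite /tent; have [h|h] := lerP 0 (v - 2^-1);
  [rewrite ger0_norm|rewrite ltr0_norm]; try lra.
  rewrite (min_l (x := 2^-1)); last lra.
  by case: (ltP (1 - a) v) => ?; max_lra.
by rewrite (min_r (x := 2^-1)) ?(min_r (x := 1 - a)); try lra; max_lra.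
Qed.

Lemma tent_lipschitz a u v : `|tent a u - tent a v| <= `|u - v|.
Proof.
rewrite /tent; have := ler_dist_dist (u - 2^-1) (v - 2^-1).
rewrite (_ : u - 2^-1 - (v - 2^-1) = u - v); last lra.
move: `|u - 2^-1| `|v - 2^-1| => x y; rewrite !ler_norml => /andP[h1 h2].
by apply/andP; split; max_lra.
Qed.

Lemma dtent_values a v : [\/ dtent a v = 0, dtent a v = 1 | dtent a v = -1].
Proof.
rewrite /dtent !indicE !mem_setE !in_itv/=.
have [h|h] := ltP v 2^-1.
  rewrite andbT (_ : 2^-1 < v = false) ?andFb ?subr0; last lra.
  by case: (a < v); [apply: Or32|apply: Or31].
rewrite andbF sub0r; case: (_ && _); [apply: Or33|apply: Or31] => //.
by rewrite oppr0.
Qed.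

Lemma ellE u : I u -> ell u = tent 0 u.
Proof.
rewrite unit_itvE => /andP[u0 u1]; rewrite /ell /tent.
by have [h|h] := lerP (2^-1) u; max_lra.
Qed.

Lemma sigmaE u : sigma u = dtent 0 u.
Proof. by rewrite /sigma /dtent subr0. Qed.

End tent.

(** * The copulas L_b *)

Section Lb.
Context {R : realType}.
Local Notation leb := (@lebesgue_measure R).
Local Notation I := (@unit_itv R).
Variable b : R.
Hypothesis hb : -1 <= b <= 1.

Let r01 : 0 <= `|b| <= 1.
Proof. by rewrite normr_ge0 ler_norml. Qed.

Let alpha01 : 0 <= alphab b <= 2^-1.
Proof. by rewrite /alphab; case/andP: r01 => *; apply/andP; split; lra. Qed.

Let sg_values : [\/ Num.sg b = 0, Num.sg b = 1 | Num.sg b = -1].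
Proof. by case: sgrP => _; [apply: Or31|apply: Or32|apply: Or33]. Qed.

Lemma gbE v : gb b v = Num.sg b * tent (alphab b) v.
Proof. by rewrite /gb /tent; congr (_ * Num.max _ _); rewrite /alphab; lra. Qed.

Lemma dgbE v : dgb b v = Num.sg b * dtent (alphab b) v.
Proof.
rewrite /dgb /dtent -mulrBr (_ : gammab b = 1 - alphab b)//.
by rewrite /gammab /alphab; lra.
Qed.

Lemma gb_lipschitz u v : `|gb b u - gb b v| <= `|u - v|.
Proof.
rewrite !gbE -mulrBr normrM -[leRHS]mul1r ler_pM// ?tent_lipschitz//.
by case: sg_values => ->; rewrite ?normr0 ?normrN1 ?normr1.
Qed.

Lemma gb0 : gb b 0 = 0.
Proof.
rewrite /gb max_r ?mulr0// sub0r normrN (@ger0_norm _ 2^-1) ?invr_ge0//.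
by case/andP: r01; lra.
Qed.

Lemma gb1 : gb b 1 = 0.
Proof.
rewrite /gb max_r ?mulr0// (@ger0_norm _ (1 - 2^-1)); last lra.
by case/andP: r01; lra.
Qed.

Lemma ell0 : ell 0 = 0 :> R.
Proof. by rewrite /ell subr0 min_l. Qed.

Lemma ell1 : ell 1 = 0 :> R.
Proof. by rewrite /ell subrr min_r. Qed.

(** The volume of the rectangle is x y + p q, where x and y are its sides and p
    and q the increments of [ell] and [g_b], which are 1-Lipschitz. *)
Lemma Lb_2increasing (u1 u2 v1 v2 : R) : I u1 -> I v1 -> u1 <= v1 -> u2 <= v2 ->
  0 <= Lb b v1 v2 - Lb b u1 v2 - Lb b v1 u2 + Lb b u1 u2.
Proof.
move=> Iu Iv uv1 uv2.
rewrite (_ : _ + _ = (v1 - u1) * (v2 - u2) +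
    (ell v1 - ell u1) * (gb b v2 - gb b u2)); last first.
  by rewrite /Lb; ring.
rewrite addrC -[X in _ + X]opprK subr_ge0 -[_ * (gb _ _ - _)]opprK lerN2.
apply: le_trans (ler_norm _) _; rewrite normrN normrM ler_pM// ?ellE//.
  by apply: le_trans (tent_lipschitz _ _ _) _; rewrite ger0_norm// subr_ge0.
by apply: le_trans (gb_lipschitz _ _) _; rewrite ger0_norm// subr_ge0.
Qed.

Lemma Lb_copula : is_copula (Lb b).
Proof.
have L0 u : Lb b u 0 = 0 by rewrite /Lb gb0 !mulr0 addr0.
have L0' v : Lb b 0 v = 0 by rewrite /Lb ell0 !mul0r addr0.
have L1 u : Lb b u 1 = u by rewrite /Lb gb1 mulr0 addr0 mulr1.
have L1' v : Lb b 1 v = v by rewrite /Lb ell1 mul0r addr0 mul1r.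
have I0 := @unit_itv0 R; have I1 := @unit_itv1 R.
split=> [u v Iu Iv|//|//|//|//|u1 u2 v1 v2 Iu1 Iu2 Iv1 Iv2]; last first.
  exact: Lb_2increasing.
have := Iu; have := Iv; rewrite !unit_itvE => /andP[v0 v1] /andP[u0 u1].
have := Lb_2increasing I0 Iu u0 v0; rewrite !L0 !L0' !subr0 addr0 => -> /=.
have := Lb_2increasing I0 Iu u0 v1; rewrite !L0' !L1; lra.
Qed.

Lemma cbE z : cb b z = 1 + (dtent 0 z.1 * Num.sg b) * dtent (alphab b) z.2.
Proof. by rewrite /cb sigmaE dgbE mulrA. Qed.

Lemma cb_values z : [\/ cb b z = 0, cb b z = 1 | cb b z = 2].
Proof.
rewrite cbE.
by case: (dtent_values 0 z.1) => ->; case: sg_values => ->;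
  case: (dtent_values (alphab b) z.2) => ->;
  rewrite ?(mulr0, mul0r, mulr1, mul1r, mulrNN, mulrN, mulNr, addr0, oppr0)
    ?(opprK, subrr);
  (try by apply: Or31); (try by apply: Or32); (try by apply: Or33).
Qed.

Lemma cb_ge0 z : 0 <= cb b z.
Proof. by case: (cb_values z) => ->. Qed.

Lemma measurable_cb : measurable_fun setT (cb b).
Proof.
rewrite (_ : cb b = fun z =>
    1 + (dtent 0 z.1 * Num.sg b) * dtent (alphab b) z.2); last first.
  by apply/funext => z; exact: cbE.
apply: measurable_funD => //; apply: measurable_funM; last first.
  by apply: measurableT_comp => //; exact: measurable_dtent.
apply: measurable_funM => //; apply: measurableT_comp => //.
exact: measurable_dtent.
Qed.

Lemma integral_cb_section s v : I v ->
  (\int[leb]_(t in `[0%R, v]) (cb b (s, t))%:E = (v + sigma s * gb b v)%:E)%E.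
Proof.
move=> Iv; under eq_integral do rewrite cbE/=.
by rewrite integral_dtent// mul1r sigmaE gbE mulrA.
Qed.

Lemma Lb_density : is_copula_density (Lb b) (cb b).
Proof.
split=> [|z _|u v Iu Iv].
- by apply: measurable_funTS; exact: measurable_cb.
- exact: cb_ge0.
- under eq_integral do rewrite integral_cb_section// sigmaE [_ * gb _ _]mulrC.
  have h : 0 <= (0 : R) <= 2^-1 by apply/andP; split; lra.
  by rewrite integral_dtent// /Lb ellE// [v * u]mulrC [gb b v * _]mulrC.
Qed.

Lemma sigma_left (u : R) : 0 < u < 2^-1 -> sigma u = 1 :> R.
Proof.
move=> /andP[u0 u1]; rewrite /sigma !indicE !mem_setE !in_itv/= u0 u1.
by rewrite (_ : 2^-1 < u = false) ?subr0//; lra.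
Qed.

Lemma sigma_right (u : R) : 2^-1 < u < 1 -> sigma u = -1 :> R.
Proof.
move=> /andP[u0 u1]; rewrite /sigma !indicE !mem_setE !in_itv/= u0 u1.
by rewrite (_ : u < 2^-1 = false) ?andbF ?sub0r//; lra.
Qed.

Lemma is_derive_Lb_left (u v : R) : 0 < u < 2^-1 ->
  is_derive u 1 (fun s => Lb b s v) (Fplus b v).
Proof.
move=> hu; have uJ : u \in `]0, 2^-1[ by rewrite in_itv/=.
have D : is_derive u 1 (fun s : R => s * Fplus b v) (Fplus b v).
  by apply: is_derive_eq; rewrite scaler0 add0r /GRing.scale/= mulr1.
apply: near_eq_is_derive D.
near=> s; have : s \in `]0, 2^-1[ by near: s; exact: near_in_itvoo.
by rewrite in_itv/= => /andP[s0 s1]; rewrite /Lb /ell min_l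
  /Fplus ?mulrDr//; lra.
Unshelve. all: by end_near.
Qed.

Lemma is_derive_Lb_right (u v : R) : 2^-1 < u < 1 ->
  is_derive u 1 (fun s => Lb b s v) (Fminus b v).
Proof.
move=> hu; have uJ : u \in `]2^-1, 1[ by rewrite in_itv/=.
have D : is_derive u 1 (fun s : R => gb b v + s * Fminus b v) (Fminus b v).
  by apply: is_derive_eq; rewrite add0r mul1r scaler0 add0r
    /GRing.scale/= mulr1.
apply: near_eq_is_derive D.
near=> s; have : s \in `]2^-1, 1[ by near: s; exact: near_in_itvoo.
rewrite in_itv/= => /andP[s0 s1]; rewrite /Lb /ell min_r; last lra.
by rewrite /Fminus; ring.
Unshelve. all: by end_near.
Qed.

(** Cutting the second coordinate to [0, 1], but not the first, keeps every
    section a probability density: [sigma] vanishes off ]0, 1[, so that the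
    sections are there uniform. *)
Definition cb_ext (z : R * R) : \bar R := (cb b z * \1_I z.2)%:E.

Lemma measurable_cb_ext : measurable_fun setT cb_ext.
Proof.
apply/measurable_EFinP; apply: measurable_funM; first exact: measurable_cb.
apply: (measurableT_comp _ measurable_snd); apply: measurable_indic.
exact: measurable_unit_itv.
Qed.

Lemma cb_ext_ge0 z : (0 <= cb_ext z)%E.
Proof. by rewrite lee_fin mulr_ge0// cb_ge0. Qed.

Lemma integral_cb_ext s B : measurable B ->
  (\int[leb]_(t in B) cb_ext (s, t) =
   \int[leb]_(t in B `&` I) (cb b (s, t))%:E)%E.
Proof.
move=> mB; rewrite integral_mkcondr; apply: eq_integral => t _.
by rewrite /cb_ext patchE indicE/=; case: ifPn => _; rewrite ?mulr1 ?mulr0.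
Qed.

Lemma integral_cb_ext1 s : (\int[leb]_t cb_ext (s, t) = 1)%E.
Proof.
rewrite integral_cb_ext// setTI integral_cb_section; last exact: unit_itv1.
by rewrite gb1 mulr0 addr0.
Qed.

Lemma measurable_id_borel : measurable_fun setT (id : measurableTypeR R -> R).
Proof. by []. Qed.

Definition Lb_kernel : R.-pker R ~> R :=
  density_kernel (mu := leb) measurable_id_borel
    measurable_cb_ext cb_ext_ge0 integral_cb_ext1.

Lemma Lb_kernelE s B : measurable B ->
  Lb_kernel s B = (\int[leb]_(t in B `&` I) (cb b (s, t))%:E)%E.
Proof. exact: integral_cb_ext. Qed.

Lemma Lb_kernel_markov : is_markov_kernel (Lb b) Lb_kernel.
Proof.
apply: (copula_density_kernel Lb_copula Lb_density) => s _ B mB.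
exact: Lb_kernelE.
Qed.

Lemma Lb_kernel_cdf s v : I v ->
  Lb_kernel s `[0, v]%classic = (v + sigma s * gb b v)%:E.
Proof.
move=> Iv; rewrite Lb_kernelE; last exact: measurable_itv.
rewrite (_ : `[0, v] `&` I = `[0, v]%classic) ?integral_cb_section//.
by apply: setIidl; exact: sub_unit_itv.
Qed.

(** The distribution function of the kernel at [s].  Any [s] in ]0, 1/2[ gives
    F_b^+ and any [s] in ]1/2, 1[ gives F_b^-. *)
Lemma Lb_distribution_function s :
  is_distribution_function (fun v => v + sigma s * gb b v).
Proof.
pose P : probability R R := density_law (mu := leb) measurable_id_borel
  (measurable_section measurable_cb_ext s)
  (fun t => cb_ext_ge0 (s, t)) (integral_cb_ext1 s).
exists P => [|v Iv]; last exact: Lb_kernel_cdf.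
transitivity (1 + sigma s * gb b 1)%:E; last by rewrite gb1 mulr0 addr0.
exact: (Lb_kernel_cdf s (@unit_itv1 R)).
Qed.

(** The kernel agrees almost everywhere with the one given by the density on all
    [0, q] with q rational, hence on all [0, v].  The points 0, 1/2 and 1,
    where [sigma] vanishes, form a null set. *)
Lemma markov_kernel_Lb_ae (K : R.-pker R ~> R) : is_markov_kernel (Lb b) K ->
  {ae leb, forall u : R, I u -> forall v : R, I v ->
     K u `[0, v]%classic = ('D_1 (fun s => Lb b s v) u)%:E}.
Proof.
move=> hK.
have eqK (q : rat) : {ae leb, forall u, I u ->
    K u `[0, ratr q]%classic = Lb_kernel u `[0, ratr q]%classic}.
  apply: (markov_kernel_ae_unique Lb_copula hK Lb_kernel_markov).
  exact: measurable_itv.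
have {}eqK : {ae leb, forall u, forall q : rat, I u ->
    K u `[0, ratr q]%classic = Lb_kernel u `[0, ratr q]%classic}.
  (* Countability of the rationals: indices that encode none hold trivially. *)
  have /ae_foralln : forall n, {ae leb, forall u,
      I u -> forall q, unpickle n = Some q ->
      K u `[0, ratr q]%classic = Lb_kernel u `[0, ratr q]%classic}.
    move=> n; case E : (unpickle n) => [q|]; last by apply: aeW.
    by move: (eqK q); apply: filterS => u h Iu _ [<-]; exact: h.
  by apply: filterS => u h q Iu; apply: (h (pickle q)) => //; rewrite pickleK.
have notin (x : R) : {ae leb, forall u, u != x}.
  exists [set x]; split => //; first exact: lebesgue_measure_set1.
  by move=> u /= /negP; rewrite negbK => /eqP.
have generic : {ae leb, forall u, [/\ u != 0, u != 1 & u != 2^-1]}.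
  by move: (notin 0) (notin 1) (notin 2^-1); apply: filterS3.
move: generic eqK; apply: filterS2 => u [u0 u1 uh] Ku Iu v Iv.
have KF : K u `[0, v]%classic = (v + sigma u * gb b v)%:E.
  (* The constant 2 adds the Lipschitz constants of v and of g_b. *)
  apply: (@eq_cdf_rat _ _ (fun v => v + sigma u * gb b v) 2) =>
    // [x y xy|q Iq].
    have sg1 : `|sigma u| <= 1.
      by rewrite sigmaE; case: (dtent_values 0 u) => ->;
        rewrite ?normr0 ?normrN1 ?normr1.
    rewrite opprD addrACA -mulrBr; apply: le_trans (ler_normD _ _) _.
    rewrite normrM distrC (@ger0_norm _ (y - x)) ?subr_ge0//.
    rewrite mulr_natl mulr2n lerD2l.
    rewrite -[leRHS]mul1r ler_pM//.
    by apply: le_trans (gb_lipschitz _ _) _; rewrite distrC ger0_norm ?subr_ge0.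
  by rewrite Ku// Lb_kernel_cdf.
rewrite KF; congr EFin.
move: Iu; rewrite unit_itvE => /andP[]; rewrite !le_eqVlt.
rewrite (negbTE u1) eq_sym (negbTE u0)/= => u0' u1'.
case: (ltgtP u 2^-1) uh => // h _.
  have hu : 0 < u < 2^-1 by rewrite u0'.
  have := is_derive_Lb_left v hu => D; rewrite derive_val sigma_left// mul1r.
  by [].
have hu : 2^-1 < u < 1 by rewrite h.
have := is_derive_Lb_right v hu => D; rewrite derive_val sigma_right// mulN1r.
by [].
Qed.

End Lb.

Theorem proposition2 (R : realType) (b : R) (hb : -1 <= b <= 1) :
  [/\ is_copula (Lb b),
      is_copula_density (Lb b) (cb b)
      /\ (forall c : R * R -> R, is_copula_density (Lb b) c ->
            {ae (lebesgue_measure \x lebesgue_measure)%E,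
               forall z, unit_square z -> c z = cb b z})
    & forall z, unit_square z -> [\/ cb b z = 0, cb b z = 1 | cb b z = 2]]
  /\
  [/\ forall u v : R, 0 < u < 2^-1 -> unit_itv v ->
        is_derive u 1 (fun s => Lb b s v) (Fplus b v),
      forall u v : R, 2^-1 < u < 1 -> unit_itv v ->
        is_derive u 1 (fun s => Lb b s v) (Fminus b v),
      exists2 K : R.-pker R ~> R, is_markov_kernel (Lb b) K &
        (forall u v : R, 0 < u < 2^-1 -> unit_itv v ->
           K u `[0, v]%classic = (Fplus b v)%:E)
        /\ (forall u v : R, 2^-1 < u < 1 -> unit_itv v ->
              K u `[0, v]%classic = (Fminus b v)%:E)
    & forall K : R.-pker R ~> R, is_markov_kernel (Lb b) K ->
        {ae lebesgue_measure, forall u : R, unit_itv u ->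
           forall v : R, unit_itv v ->
             K u `[0, v]%classic = ('D_1 (fun s => Lb b s v) u)%:E}]
  /\
  [/\ is_distribution_function (Fplus b),
      is_distribution_function (Fminus b)
    & forall v : R, unit_itv v ->
        2^-1 * Fplus b v + 2^-1 * Fminus b v = v].
Proof.
have plusE u v : 0 < u < 2^-1 -> v + sigma u * gb b v = Fplus b v.
  by move=> hu; rewrite sigma_left// mul1r.
have minusE u v : 2^-1 < u < 1 -> v + sigma u * gb b v = Fminus b v.
  by move=> hu; rewrite sigma_right// mulN1r.
split; [split|split; split].
- exact: Lb_copula.
- split=> [|c dc]; first exact: Lb_density.
  exact: (copula_density_ae_unique (Lb_copula hb) dc (Lb_density hb)).
- by move=> z _; exact: cb_values.
- by move=> u v hu _; exact: is_derive_Lb_left.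
- by move=> u v hu _; exact: is_derive_Lb_right.
- exists (Lb_kernel hb); first exact: Lb_kernel_markov.
  split=> u v hu Iv; rewrite Lb_kernel_cdf//.
    by rewrite plusE.
  by rewrite minusE.
- by move=> K; exact: markov_kernel_Lb_ae.
- have hu : 0 < (4^-1 : R) < 2^-1 by apply/andP; split; lra.
  rewrite (_ : Fplus b = fun v => v + sigma 4^-1 * gb b v); last first.
    by apply/funext => v; rewrite plusE.
  exact: Lb_distribution_function.
- have hu : 2^-1 < (3 / 4 : R) < 1 by apply/andP; split; lra.
  rewrite (_ : Fminus b = fun v => v + sigma (3 / 4) * gb b v); last first.
    by apply/funext => v; rewrite minusE.
  exact: Lb_distribution_function.
- by move=> v _; rewrite /Fplus /Fminus; lra.
Qed.
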